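(* Let $A \in \mathcal M_d(\mathbb R)$ and let $\tau$ be a delay function such that: $\inf_{s \in [0, t]} \tau(s) > 0$ for every $t \geq 0$; $\tau$ is $(\mathfrak L, \mathfrak L)$-measurable; and, with $\sigma_1(t) = t - \tau(t)$ for $t \in \mathbb R_+$, $\mathcal L(\sigma_1^{-1}(N)) = 0$ for every $N \in \mathfrak L$ with $\mathcal L(N) = 0$. Let $h$ be the largest delay function associated with $\tau$ and let $x_0 \in L^\infty(\lvert -h(0), 0], \mathbb R^d)$. Then there exists a unique $L^\infty$ solution $x \in L^\infty_{\mathrm{loc}}(\lvert -h(0), +\infty), \mathbb R^d)$ of $$x(t) = A x(t - \tau(t)), \qquad t \geq 0,$$ with initial condition $x_0$.
   Context: $\mathbb R_+ = [0, +\infty)$, $\mathbb R_+^\ast = (0, +\infty)$; $\mathcal M_d(\mathbb R)$ is the set of real $d \times d$ matrices, $d$ a positive integer; $\mathfrak L$, $\mathfrak B$ are the Lebesgue and Borel $\sigma$-algebras and $\mathcal L$ is Lebesgue measure. A map $f\colon X \to Y$ is $(\mathfrak S_X, \mathfrak S_Y)$-measurable if $f^{-1}(B) \in \mathfrak S_X$ for all $B \in \mathfrak S_Y$. For $a \leq b$ in $\mathbb R \cup \{\pm\infty\}$, $\lvert a, b]$ denotes $[a, b]$ if $a > -\infty$ and $(a, b]$ if $a = -\infty$; $\lvert a, b)$ is defined similarly. A \emph{delay function} is any function $\tau\colon \mathbb R_+ \to \mathbb R_+^\ast$. Its \emph{largest delay function} is $h\colon \mathbb R_+ \to \mathbb R_+^\ast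 \cup \{+\infty\}$, $h(t) = t - \inf_{s \in [t, +\infty)} (s - \tau(s))$. An \emph{a.e. solution} is a function $x\colon \lvert -h(0), +\infty) \to \mathbb R^d$ such that, for every $\widetilde x\colon \lvert -h(0), +\infty) \to \mathbb R^d$ equal to $x$ a.e., we have $\widetilde x(t) = A \widetilde x(t - \tau(t))$ for a.e. $t \in \mathbb R_+$. For $p \in [1, +\infty]$, an \emph{$L^p$ solution} is an $(\mathfrak L, \mathfrak B)$-measurable a.e. solution $x$ with $x \in L^p_{\mathrm{loc}}(\lvert -h(0), +\infty), \mathbb R^d)$. Its \emph{initial condition} is its restriction to $\lvert -h(0), 0)$. Equality with the initial condition and uniqueness are understood up to a.e. equality. *)

(* Defs.v *)
From HB Require Import structures.
From mathcomp Require Import all_boot all_order all_algebra.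
From mathcomp Require Import all_classical all_reals all_analysis.
Set Implicit Arguments.
Unset Strict Implicit.
Unset Printing Implicit Defensive.
Import Order.TTheory GRing.Theory Num.Theory.
Import numFieldNormedType.Exports.

Local Open Scope classical_set_scope.
Local Open Scope ring_scope.

(* The real line with the Lebesgue (Caratheodory) sigma-algebra, as opposed to
   the Borel sigma-algebra, which is the default one on R. *)
Notation lebesgueT R :=
  (caratheodory_type (measure_extension.mu_ext (@wlength R idfun))).

Notation leb R := (@completed_lebesgue_measure R).

Notation Rplus R := ([set t : R | 0 <= t] : set R).

Notation borelT T := (g_sigma_algebraType [set U : set T | open U]).

Section defs.
Context {R : realType}.
Implicit Types (tau : R -> R) (t : R) (p : \bar R) (D : set R).

(* Functions on R_+ and on |-h(0), +oo) are represented by functions on R whose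
   values outside of these domains are irrelevant. *)

Definition delay_function tau := forall t, 0 <= t -> 0 < tau t.

(* The source and target are given explicitly: R alone would carry the Borel
   sigma-algebra. *)
Definition LL_measurable D (f : R -> R) :=
  @measurable_fun _ _ (lebesgueT R) (lebesgueT R) D f.

Definition largest_delay tau t : \bar R :=
  (t%:E - ereal_inf [set (s - tau s)%:E | s in [set s : R | (t <= s)%R]])%E.

(* |-h(0), +oo), |-h(0), 0] and |-h(0), 0); when h(0) = +oo the lower
   bound is vacuous, so the interval is automatically open at -oo. *)
Definition sol_dom tau : set R := [set t : R | (- largest_delay tau 0 <= t%:E)%E].
Definition init_domc tau : set R := sol_dom tau `&` `]-oo, 0].
Definition init_domo tau : set R := sol_dom tau `&` `]-oo, 0[.

Section vector_valued.
Context {d : nat}.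
Implicit Types (x : R -> 'cV[R]_d) (A : 'M[R]_d).

Definition LB_measurable D x :=
  @measurable_fun _ _ (lebesgueT R) (borelT 'cV[R]_d) D x.

(* For d > 0, `|x t| is the sup norm on R^d; the choice of norm does not affect
   membership in L^p. *)
Definition memLp p D x :=
  LB_measurable D x /\
  (Lnorm (leb R) p ((fun t => `|x t|%:E) \_ D) < +oo)%E.

Definition memLp_loc p D x :=
  LB_measurable D x /\
  forall K : set R, compact K -> K `<=` D -> memLp p K x.

Definition ae_solution A tau x :=
  forall y : R -> 'cV[R]_d,
    y = x %[ae leb R in sol_dom tau] ->
    \forall t \ae leb R, Rplus R t -> y t = A *m y (t - tau t).

Definition Lp_solution p A tau x :=
  [/\ LB_measurable (sol_dom tau) x,
      ae_solution A tau x &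
      memLp_loc p (sol_dom tau) x].

Definition has_initial_condition tau x (x0 : R -> 'cV[R]_d) :=
  x = x0 %[ae leb R in init_domo tau].

End vector_valued.

End defs.

(* Main.v *)
(* With sigma(t) = t - tau(t) and delta = inf tau > 0 on [0, T], finitely many
   applications of sigma bring any t in [0, T] below 0.  Hence the iterates
   x_0 = x0, x_(n+1)(t) = x0(t) for t < 0 and A x_n(sigma(t)) for t >= 0 are
   eventually constant on ]-oo, T], and their limit is an everywhere solution.
   Since preimages of null sets under sigma are null, sigma is (L, L)-measurable
   and so are the iterates; the same property makes the equation, and hence
   uniqueness, insensitive to null sets: the bad set of one step is pulled back
   by sigma only finitely often on each [0, T]. *)
Require Import Defs.
From mathcomp Require Import all_boot all_order all_algebra.
From mathcomp Require Import all_classical all_reals all_analysis.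
From mathcomp Require Import measurable_realfun ess_sup_inf.
Set Implicit Arguments.
Unset Strict Implicit.
Unset Printing Implicit Defensive.
Import Order.TTheory GRing.Theory Num.Theory.
Import numFieldNormedType.Exports.
Local Open Scope classical_set_scope.
Local Open Scope ring_scope.

(** * Lebesgue and Borel measurability, and null sets *)

Section lebesgue_sigma_algebra.
Context {R : realType}.
Implicit Types (D N : set R) (f : R -> R).

(* [ae_filter_ringOfSetsType] is not found by unification at [lebesgueT R]. *)
#[export] Instance ae_leb_filter : Filter (nbhs (almost_everywhere (leb R))).
Proof. exact: (@ae_filter_ringOfSetsType _ (lebesgueT R) R (leb R)). Qed.

Lemma borel_lebesgue_measurable D :
  @measurable _ (measurableTypeR R) D -> @measurable _ (lebesgueT R) D.
Proof. exact: sub_caratheodory. Qed.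

Lemma negligible_lebesgue_measurable N :
  (leb R).-negligible N -> @measurable _ (lebesgueT R) N.
Proof. exact: completed_lebesgue_measure_is_complete. Qed.

(** [leb R] is an outer measure defined on all sets, and a set of outer measure 0 splits every [X]
    additively. Measurability thus comes for free, as is needed for preimages of null sets. *)
Lemma leb0_negligible N : leb R N = 0%E -> (leb R).-negligible N.
Proof.
move=> N0; apply/negligibleP => //.
apply: le_caratheodory_measurable => X.
have le0 : (leb R (X `&` N) <= 0)%E by rewrite -N0; exact: le_outer_measure.
apply: (@le_trans _ _ (0 + leb R (X `&` ~` N))%E); first by rewrite leeD2r.
by rewrite add0e; apply: le_outer_measure; exact: subIsetl.
Qed.

Lemma negligible_lebesgue N :
  (@lebesgue_measure R).-negligible N -> (leb R).-negligible N.
Proof.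
move=> [B [mB B0 NB]]; exists B; split => //; exact: borel_lebesgue_measurable.
Qed.

(** The Caratheodory sigma-algebra is the completion of the Borel one, and completing only adjoins
    negligible sets to Borel sets. *)
Lemma lebesgue_measurable_decomp D : @measurable _ (lebesgueT R) D ->
  exists B N, [/\ @measurable _ (measurableTypeR R) B,
    (leb R).-negligible N & D = B `|` N].
Proof.
rewrite -completed_caratheodory_measurable g_sigma_completed_algebra_genE.
move=> [B mB [N nN <-]]; exists B, N; split => //.
exact: negligible_lebesgue.
Qed.

(* A Lebesgue set is Borel up to a null set, so Borel measurability together
   with the preservation of null sets under preimages suffices. *)
Lemma LL_measurable_null D f : @measurable _ (lebesgueT R) D ->
  @measurable_fun _ _ (lebesgueT R) (measurableTypeR R) D f ->
  (forall N, (leb R).-negligible N -> (leb R).-negligible (D `&` f @^-1` N)) ->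
  LL_measurable D f.
Proof.
move=> mD mf nf _ Y /lebesgue_measurable_decomp [B [N [mB nN ->]]].
rewrite preimage_setU setIUr; apply: measurableU; first exact: mf.
exact/negligible_lebesgue_measurable/nf.
Qed.

Lemma LL_measurable_borel D f : LL_measurable D f ->
  @measurable_fun _ _ (lebesgueT R) (measurableTypeR R) D f.
Proof.
by move=> mf mD Y mY; apply: mf => //; exact: borel_lebesgue_measurable.
Qed.

Lemma measurable_lebesgue_id D :
  @measurable_fun _ _ (lebesgueT R) (measurableTypeR R) D idfun.
Proof.
by move=> mD Y mY; apply: measurableI => //; exact: borel_lebesgue_measurable.
Qed.

End lebesgue_sigma_algebra.

(** * Finite essential supremum as an almost everywhere bound *)

Lemma Lnorm_oo_ltyP d (T : measurableType d) (R : realType)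
    (mu : {measure set T -> \bar R}) (V : normedZmodType R)
    (D : set T) (x : T -> V) :
  (Lnorm mu +oo%E ((fun t => `|x t|%:E) \_ D) < +oo)%E <->
  exists M : R, \forall t \ae mu, D t -> `|x t| <= M.
Proof.
have absE t : (abse \o ((fun t => `|x t|%:E) \_ D)) t =
    (if t \in D then `|x t|%:E else 0%E).
  by rewrite /= patchE; case: ifP => _ /=; rewrite ?normr_id ?normr0.
(* On a space of measure 0 the norm is 0 by convention and every property holds a.e. *)
rewrite unlock; case: ifPn => [mu0|]; last first.
  rewrite -leNgt measure_le0 => /eqP mu0; split => // _; exists 0.
  exists setT; split => //.
split=> [|[M xM]].
  move: (ess_sup_ge mu (abse \o ((fun t => `|x t|%:E) \_ D))).
  case: (ess_sup _ _) => [M| |] // + _.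
    move=> xM; exists M; apply: filterS xM => t; rewrite absE => + Dt.
    by rewrite mem_set// lee_fin.
  (* With [-oo] the a.e. inequality is absurd on [D], so any bound serves. *)
  move=> xM; exists 0; apply: filterS xM => t; rewrite absE => + Dt.
  by rewrite mem_set.
(* The function vanishes outside [D], so the bound must also dominate 0, while [M] may be
   negative. *)
apply: (@le_lt_trans _ _ (Num.max 0 M)%:E); last exact: ltry.
apply/ess_supP; apply: filterS xM => t xM; rewrite absE; case: ifPn => [|_].
  by rewrite inE => /xM xtM; rewrite lee_fin le_max xtM orbT.
by rewrite lee_fin le_max lexx.
Qed.

(** * Boundedness and continuity of multiplication by [A] *)

Section mulmx_bound.
Context {R : realType} {d : nat} (A : 'M[R]_d).
Implicit Type v : 'cV[R]_d.

Lemma le_mx_norm_coord v i : `|v i 0| <= `|v|.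
Proof.
rewrite [leRHS]/Num.norm /= mx_normrE.
exact: (le_bigmax _ (fun k : 'I_d * 'I_1 => `|v k.1 k.2|) (i, 0)).
Qed.

(** Each row sum of absolute values is at most [S]. The added 1 gives [1 <= C], so that the powers
    of [C] never fall below 1 in [delay_iter_bound]. *)
Lemma mulmx_norm_bound :
  exists2 C : R, 1 <= C & forall v, `|A *m v| <= C * `|v|.
Proof.
pose S := \sum_i \sum_j `|A i j|.
have S0 : 0 <= S by apply: sumr_ge0 => i _; exact: sumr_ge0.
exists (1 + S) => [|v]; first by rewrite lerDl.
rewrite [leLHS]/Num.norm /= mx_normrE.
apply/bigmax_leP; split; first by rewrite mulr_ge0// addr_ge0.
move=> [i k] _ /=; rewrite ord1 mxE.
apply: (@le_trans _ _ ((\sum_j `|A i j|) * `|v|)).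
  rewrite mulr_suml; apply: le_trans (ler_norm_sum _ _ _) _.
  by apply: ler_sum => j _; rewrite normrM ler_wpM2l// le_mx_norm_coord.
apply: ler_wpM2r => //; rewrite /S [in leRHS](bigD1 i)//=.
by rewrite addrCA lerDl addr_ge0// sumr_ge0// => k' _; exact: sumr_ge0.
Qed.

Lemma mulmx_continuous : continuous (fun v => A *m v).
Proof.
have [C C1 AC] := mulmx_norm_bound.
apply: (@bounded_linear_continuous _ _ _ (mulmx A)); apply/bounded_funP => r.
exists (C * r) => v vr; apply: le_trans (AC v) _.
by rewrite ler_wpM2l// (le_trans _ C1).
Qed.

Lemma LB_measurable_mulmx D (x : R -> 'cV[R]_d) :
  LB_measurable D x -> LB_measurable D (fun t => A *m x t).
Proof.
apply: (@measurableT_comp _ _ _ _ (borelT 'cV[R]_d) (borelT 'cV[R]_d)).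
apply: (@measurability _ _ (borelT 'cV[R]_d) (borelT 'cV[R]_d) _ _
  [set U | open U]) => //.
move=> _ [U oU <-]; rewrite setTI; apply: sub_sigma_algebra.
by apply: open_comp oU => v _; exact: mulmx_continuous.
Qed.

End mulmx_bound.

(** * Iterates of the delay equation and their stabilization *)

Section delay_iteration.
Context {R : realType} {V : Type} (tau : R -> R) (F : V -> V) (xi : R -> V).
Hypothesis tau_inf : forall t, 0 <= t -> 0 < inf [set tau s | s in `[0, t]].

Fixpoint delay_iter n t : V :=
  if n is m.+1 then if t < 0 then xi t else F (delay_iter m (t - tau t))
  else xi t.

Lemma delay_iter_lt0 n t : t < 0 -> delay_iter n t = xi t.
Proof. by case: n => //= n ->. Qed.

Lemma delay_lower_bound T :
  exists2 delta, 0 < delta & forall s, 0 <= s <= T -> delta <= tau s.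
Proof.
have [T0|T0] := leP 0 T; last first.
  exists 1 => // s /andP[s0 sT].
  by have := lt_le_trans T0 (le_trans s0 sT); rewrite ltxx.
have I0 := tau_inf T0; exists (inf [set tau s | s in `[0, T]]) => // s sT.
apply: ge_inf; last by exists s => //=; rewrite in_itv.
have [[]//|noinf] := pselect (has_inf [set tau s | s in `[0, T]]).
(* [inf] is 0 by default on a set without infimum, which its positivity excludes. *)
by rewrite inf_out// ltxx in I0.
Qed.

Lemma delay_iter_stable T : exists N, forall m t, (N <= m)%N -> t <= T ->
  delay_iter m t = delay_iter N t.
Proof.
have [delta delta0 tau_ge] := delay_lower_bound T.
(* One delay lowers [t] by at least [delta], so from [t < n%:R * delta] the negative half-line,
   where all iterates are [xi], is reached within [n] delays. *)
have iter_eq n : forall m t, (n <= m)%N -> t <= T -> t < n%:R * delta ->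
    delay_iter m t = delay_iter n t.
  elim: n => [|n IH] [|m] t //; rewrite ?mul0r.
    by move=> _ _; exact: delay_iter_lt0.
  rewrite ltnS => nm tT tn /=; case: ltP => // t0; congr F.
  have tau_t : delta <= tau t by rewrite tau_ge// t0.
  apply: IH => //.
    by rewrite lerBlDr (le_trans tT)// lerDl (le_trans _ tau_t)// ltW.
  by rewrite ltrBlDr (lt_le_trans tn)// -natr1 mulrDl mul1r lerD2l.
exists (Num.truncn (Num.max 0 T / delta)).+1 => m t Nm tT; apply: iter_eq => //.
apply: (@le_lt_trans _ _ (Num.max 0 T)); first by rewrite le_max tT orbT.
by rewrite -ltr_pdivrMr// truncnS_gt.
Qed.

Lemma delay_solution_exists : exists x : R -> V,
  [/\ forall t, t < 0 -> x t = xi t,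
      forall t, 0 <= t -> x t = F (x (t - tau t)) &
      forall T, exists N, forall t, t <= T -> x t = delay_iter N t].
Proof.
have [N N_stable] := choice delay_iter_stable.
have xE T m t : t <= T -> (N T <= m)%N ->
    delay_iter (N t) t = delay_iter m t.
  (* The indices [m] and [N t] need not be ordered, so both are compared with their maximum, using
     stability at [t] and at [T]. *)
  move=> tT Tm; rewrite -(N_stable t (maxn m (N t)))// ?leq_maxr//.
  rewrite (N_stable T)//; first by rewrite -(N_stable T m).
  by rewrite (leq_trans Tm)// leq_maxl.
exists (fun t => delay_iter (N t) t); split => [t|t t0|T].
- exact: delay_iter_lt0.
- have [delta delta0 tau_ge] := delay_lower_bound t.
  have tau_t : delta <= tau t by rewrite tau_ge// t0 lexx.
  (* Raising the index from [N t] to its successor keeps the value at [t] and exposes one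
     application of [F]. *)
  rewrite (xE t (N t).+1)//= ltNge t0 /=; congr F; apply/esym/(xE t) => //.
  by rewrite gerDl oppr_le0 (le_trans _ tau_t)// ltW.
- by exists (N T) => t tT; exact: (xE T).
Qed.

End delay_iteration.

(** * The domain of solutions: stability under the delay, and measurability *)

Section delay_domain.
Context {R : realType} (tau : R -> R).

Lemma sol_domE :
  sol_dom tau = [set t |
    (ereal_inf [set (s - tau s)%:E | s in [set s | (0 <= s)%R]] <= t%:E)%E].
Proof.
by apply/seteqP; split => t /=; rewrite /sol_dom/= /largest_delay sub0e oppeK.
Qed.

Lemma sol_dom_le s t : s <= t -> sol_dom tau s -> sol_dom tau t.
Proof. by move=> st /le_trans; apply; rewrite lee_fin. Qed.

Lemma sol_dom_delay t : 0 <= t -> sol_dom tau (t - tau t).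
Proof. by move=> t0; rewrite sol_domE; apply: ereal_inf_lbound; exists t. Qed.

Lemma sol_dom_ge0 t : delay_function tau -> 0 <= t -> sol_dom tau t.
Proof.
move=> tau_gt0 t0; apply: sol_dom_le (sol_dom_delay t0).
by rewrite gerDl oppr_le0 ltW// tau_gt0.
Qed.

Lemma sol_dom_measurable : @measurable _ (lebesgueT R) (sol_dom tau).
Proof.
apply: borel_lebesgue_measurable.
have := @EFin_measurable R setT measurableT _
  (emeasurable_itv `[(- largest_delay tau 0)%E, +oo[).
rewrite setTI; congr measurable; apply/seteqP.
by split => t; rewrite /sol_dom /= in_itv /= ?andbT.
Qed.

Lemma init_domo_measurable : @measurable _ (lebesgueT R) (init_domo tau).
Proof.
apply: measurableI; first exact: sol_dom_measurable.
by apply: borel_lebesgue_measurable; exact: measurable_itv.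
Qed.

Lemma init_domc_measurable : @measurable _ (lebesgueT R) (init_domc tau).
Proof.
apply: measurableI; first exact: sol_dom_measurable.
by apply: borel_lebesgue_measurable; exact: measurable_itv.
Qed.

Lemma Rplus_measurable : @measurable _ (lebesgueT R) (Rplus R).
Proof.
apply: borel_lebesgue_measurable; rewrite -(_ : `[0, +oo[%classic = Rplus R).
  exact: measurable_itv.
by apply/seteqP; split => t; rewrite /= in_itv /= andbT.
Qed.

End delay_domain.

(** * Measurability and local bounds of the iterates and of their limit *)

Section delay_iter_LB.
Context {R : realType} {d : nat}.
Implicit Types (D : set R) (f g h x : R -> 'cV[R]_d).

Lemma LB_measurable_glue D f g h : @measurable _ (lebesgueT R) D ->
  LB_measurable D f -> LB_measurable (~` D) g ->
  {in D, f =1 h} -> {in ~` D, g =1 h} -> LB_measurable setT h.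
Proof.
move=> mD mf mg fh gh; rewrite -(setUv D) /LB_measurable.
apply/measurable_funU => //; first exact: measurableC.
by split; [exact: eq_measurable_fun mf | exact: eq_measurable_fun mg].
Qed.

Context (A : 'M[R]_d) (tau : R -> R) (xi : R -> 'cV[R]_d).
Hypothesis tau_meas : LL_measurable (Rplus R) tau.
Hypothesis tau_null : forall N : set R,
  @measurable _ (lebesgueT R) N -> leb R N = 0%E ->
  leb R ((Rplus R) `&` (fun t : R => t - tau t) @^-1` N) = 0%E.

Lemma delay_preimage_negligible N : (leb R).-negligible N ->
  (leb R).-negligible (Rplus R `&` (fun t => t - tau t) @^-1` N).
Proof.
move=> [B [mB B0 NB]].
by apply: negligibleS (leb0_negligible (tau_null mB B0)) => t [t0 /NB].
Qed.

(** Subtraction is handled with Borel target; preservation of null sets then upgrades the target to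
    Lebesgue, as composition with Lebesgue measurable iterates requires. *)
Lemma delay_LL_measurable : LL_measurable (Rplus R) (fun t => t - tau t).
Proof.
apply: LL_measurable_null; first exact: Rplus_measurable.
  apply: (@measurable_funB _ (lebesgueT R) R _ idfun tau).
    exact: measurable_lebesgue_id.
  exact: LL_measurable_borel.
exact: delay_preimage_negligible.
Qed.

Lemma delay_iter_LB_measurable n : LB_measurable setT xi ->
  LB_measurable setT (delay_iter tau (mulmx A) xi n).
Proof.
move=> mxi; elim: n => [|n IH] //.
have negC : ~` [set t : R | t < 0] = Rplus R.
  by apply/seteqP; split => t /=; rewrite leNgt => /negP.
apply: (@LB_measurable_glue [set t | t < 0] xi
    (fun t => A *m delay_iter tau (mulmx A) xi n (t - tau t))).
- rewrite -[X in measurable X]setCK negC; apply: measurableC.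
  exact: Rplus_measurable.
- exact: measurable_funTS.
- rewrite negC; apply: LB_measurable_mulmx.
  by apply: (measurableT_comp IH); exact: delay_LL_measurable.
- by move=> t; rewrite inE /= => ->.
- by move=> t; rewrite negC inE /= leNgt => /negbTE ->.
Qed.

Lemma LB_measurable_locally x :
  (forall T, exists2 y, LB_measurable setT y & forall t, t <= T -> x t = y t) ->
  LB_measurable setT x.
Proof.
move=> xT; rewrite /LB_measurable.
have -> : [set: caratheodory_type (measure_extension.mu_ext (@wlength R idfun))] =
    \bigcup_n `]-oo, n%:R]%classic :> set R.
  apply/seteqP; split => // t _; exists (Num.truncn t).+1 => //=.
  by rewrite in_itv /= ltW// truncnS_gt.
have mray n : @measurable _ (lebesgueT R) `]-oo, n%:R]%classic.
  by apply: borel_lebesgue_measurable; exact: measurable_itv.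
apply/measurable_fun_bigcup => // n.
have [y my xy] := xT n%:R.
apply: (@eq_measurable_fun _ _ (lebesgueT R) (borelT 'cV[R]_d) _ y);
  last exact: measurable_funTS.
by move=> t; rewrite inE /= in_itv /= => /xy.
Qed.

Lemma delay_iter_bound C M n t : 1 <= C ->
  (forall v : 'cV[R]_d, `|A *m v| <= C * `|v|) ->
  (forall s, `|xi s| <= M) ->
  `|delay_iter tau (mulmx A) xi n t| <= C ^+ n * M.
Proof.
move=> C1 AC xiM.
have M0 : 0 <= M by exact: le_trans (xiM 0).
have C0 : 0 <= C by exact: le_trans C1.
elim: n t => [|n IH] t /=; first by rewrite mul1r.
case: ifPn => _; last first.
  by apply: le_trans (AC _) _; rewrite exprS -mulrA ler_wpM2l.
by rewrite (le_trans (xiM t))// ler_peMl// exprn_ege1.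
Qed.

Lemma locally_bounded_memLp_loc x D : @measurable _ (lebesgueT R) D ->
  LB_measurable D x ->
  (forall T, exists M, forall t, t <= T -> `|x t| <= M) ->
  memLp_loc +oo%E D x.
Proof.
move=> mD mx xM; split => // K cK KD; split; first exact: measurable_funS mx.
apply/Lnorm_oo_ltyP.
have [B [_ KB]] := compact_bounded cK.
(* Every real beyond [B] bounds [K], hence the choice of [B + 1]. *)
have [M BM] := xM (B + 1).
exists M; apply/aeW => t Kt; apply: BM.
by rewrite (le_trans (ler_norm t))// (KB (B + 1))// ltrDl.
Qed.

End delay_iter_LB.

(** * Uniqueness up to null sets *)

Section delay_uniqueness.
Context {R : realType} {V : Type} (tau : R -> R) (F : V -> V).
Hypothesis tau_delay : delay_function tau.
Hypothesis tau_inf : forall t, 0 <= t -> 0 < inf [set tau s | s in `[0, t]].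
Hypothesis tau_null : forall N : set R, (leb R).-negligible N ->
  (leb R).-negligible (Rplus R `&` (fun t => t - tau t) @^-1` N).

Lemma ae_delay_unique (x y : R -> V) :
  (\forall t \ae leb R, Rplus R t -> x t = F (x (t - tau t))) ->
  (\forall t \ae leb R, Rplus R t -> y t = F (y (t - tau t))) ->
  y = x %[ae leb R in init_domo tau] -> y = x %[ae leb R in sol_dom tau].
Proof.
move=> xF yF yx.
pose G t := [/\ Rplus R t -> x t = F (x (t - tau t)),
  Rplus R t -> y t = F (y (t - tau t)) & init_domo tau t -> y t = x t].
have nG : (leb R).-negligible (~` G).
  have: \forall t \ae leb R, G t.
    by move: xF yF yx; apply: filterS3 => t; split.
  by [].
(* [E n] collects the points that meet the complement of [G] within [n] delays, each delay being
   taken from a point of [Rplus R]. *)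
pose E := fix E n : set R :=
  if n is m.+1 then ~` G `|` (Rplus R `&` (fun t => t - tau t) @^-1` E m)
  else ~` G.
have nE n : (leb R).-negligible (E n).
  by elim: n => //= n IH; apply: negligibleU => //; exact: tau_null.
(* Outside [E n] both equations hold at every point of the descent, until it becomes negative and
   the initial data agree. *)
have step n t delta T : 0 < delta -> (forall s, 0 <= s <= T -> delta <= tau s) ->
    t <= T -> t < n%:R * delta -> sol_dom tau t -> ~ E n t -> y t = x t.
  move=> delta0 tau_ge; elim: n t => [|n IH] t tT tn Dt nEt.
    have [_ _] := contrapT nEt; apply; split => //=.
    by rewrite in_itv/=; rewrite mul0r in tn.
  have [xt yt xyt] : G t by apply: contrapT => nGt; apply: nEt; left.
  have [t0|t0] := ltP t 0; first by apply: xyt; split => //=; rewrite in_itv.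
  have tau_t : delta <= tau t by rewrite tau_ge// t0.
  rewrite xt// yt//; congr F.
  apply: IH.
  - by rewrite lerBlDr (le_trans tT)// lerDl ltW// tau_delay.
  - by rewrite ltrBlDr (lt_le_trans tn)// -natr1 mulrDl mul1r lerD2l.
  - exact: sol_dom_delay.
  - by move=> Et; apply: nEt; right.
(* The number of delays depends on [t], so the countable union of all the [E n] is discarded. *)
apply: (negligibleS _ (negligible_bigcup nE)) => t nyx.
apply: contrapT => nEt; apply: nyx => /= Dt.
have [delta delta0 tau_ge] := delay_lower_bound tau_inf t.
apply: (step (Num.truncn (t / delta)).+1 t delta t) => //.
  by rewrite -ltr_pdivrMr// truncnS_gt.
by move=> Et; apply: nEt; eexists; last exact: Et.
Qed.

End delay_uniqueness.

(** * Existence from the limit of the iterates, and uniqueness *)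

Theorem theorem4p25 (R : realType) (d : nat) (d_gt0 : (0 < d)%N)
  (A : 'M[R]_d) (tau : R -> R)
  (tau_delay : delay_function tau)
  (tau_inf : forall t : R, 0 <= t -> 0 < inf [set tau s | s in `[0, t]])
  (tau_meas : LL_measurable (Rplus R) tau)
  (tau_null : forall N : set R, @measurable _ (lebesgueT R) N -> leb R N = 0%E ->
     leb R ((Rplus R) `&` (fun t : R => t - tau t) @^-1` N) = 0%E)
  (x0 : R -> 'cV[R]_d) (x0_Loo : memLp +oo%E (init_domc tau) x0) :
  exists x : R -> 'cV[R]_d,
    (Lp_solution +oo%E A tau x /\ has_initial_condition tau x x0) /\
    forall y : R -> 'cV[R]_d,
      Lp_solution +oo%E A tau y -> has_initial_condition tau y x0 ->
      y = x %[ae leb R in sol_dom tau].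
Proof.
have pre_null := delay_preimage_negligible tau_null.
have [mx0 /Lnorm_oo_ltyP [M x0M]] := x0_Loo.
pose N : set R := ~` [set t | init_domc tau t -> `|x0 t| <= M].
have nN : (leb R).-negligible N by [].
have mN := negligible_lebesgue_measurable nN.
have domoc : init_domo tau `<=` init_domc tau.
  move=> t [Dt]; rewrite /= in_itv /= => t0.
  by split => //=; rewrite in_itv /= ltW.
pose D := init_domo tau `\` N.
have mD : @measurable _ (lebesgueT R) D.
  by apply: measurableD => //; exact: init_domo_measurable.
(* xi is x0 modified on a null set so as to be bounded everywhere. *)
pose xi t : 'cV[R]_d := if t \in D then x0 t else 0.
have mxi : LB_measurable setT xi.
  apply: (@LB_measurable_glue _ _ D x0 (fun=> 0)) => //.
  - apply: measurable_funS mx0; first exact: init_domc_measurable.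
    by move=> t [/domoc].
  - exact: measurable_cst.
  - by move=> t tD; rewrite /xi tD.
  - by move=> t; rewrite inE => tD; rewrite /xi memNset.
have xiM t : `|xi t| <= Num.max 0 M.
  rewrite /xi; case: ifPn => [|_]; last by rewrite normr0 le_max lexx.
  rewrite inE => -[/domoc Dt nNt]; rewrite le_max; apply/orP; right.
  exact: (contrapT nNt).
have [C C1 AC] := mulmx_norm_bound A.
have [x [x_neg xA x_iter]] := delay_solution_exists (mulmx A) xi tau_inf.
have mx : LB_measurable setT x.
  apply: LB_measurable_locally => T; have [n xn] := x_iter T.
  exists (delay_iter tau (mulmx A) xi n) => //.
  exact: delay_iter_LB_measurable.
have x_init : has_initial_condition tau x x0.
  apply: negligibleS nN => t /= nxx0 xt; apply: nxx0 => Dt.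
  have t0 : t < 0 by have := Dt.2; rewrite /= in_itv.
  by rewrite x_neg// /xi mem_set//; split => // Nt; exact: Nt xt.
exists x; split; [split => //; split|].
- exact: measurable_funTS.
(* A representative [y] can violate the equation at [t >= 0] only if it differs from [x] at [t] or
   at [t - tau t]; both exceptional sets are null. *)
- move=> y yx.
  apply: (negligibleS _ (negligibleU yx (pre_null _ yx))) => t /= nyA.
  apply: contrapT => /not_orP [/contrapT yxt nyxs]; apply: nyA => t0.
  rewrite yxt; last exact: sol_dom_ge0.
  rewrite xA//; congr (_ *m _); apply/esym.
  have := nyxs; rewrite not_andP => -[//|/contrapT]; apply.
  exact: sol_dom_delay.
- apply: locally_bounded_memLp_loc; first exact: sol_dom_measurable.
    exact: measurable_funTS.
  (* Up to time [T] the solution is a single iterate, hence bounded there, by a constant depending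
     on [T] through [n]. *)
  move=> T; have [n xn] := x_iter T.
  exists (C ^+ n * Num.max 0 M) => t tT; rewrite xn//.
  exact: delay_iter_bound.
- move=> y [_ yA _] y_init; apply: (ae_delay_unique (F := mulmx A)) => //.
  + by apply/aeW => t; exact: xA.
  (* [ae_solution] ranges over all representatives; here [y] represents itself. *)
  + by apply: yA; exact/aeW.
  + by move: y_init x_init; apply: filterS2 => t yx0 xx0 Dt; rewrite yx0// xx0.
Qed.
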